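(* Let $A=(1,a_1,\ldots,a_k)$ be an orderly currency. Then for every $2\leq l\leq k$ the currency $(1,a_1,a_l)$ is orderly. In particular (when $k\geq 2$) the currency $(1,a_1,a_2)$ is orderly.
   Context: A currency is a finite sequence of integers $A=(a_0,a_1,\ldots,a_k)$ with $1=a_0<a_1<\cdots<a_k$. For an integer amount $c>0$, $\mathrm{opt}_A(c)$ is the minimum number of coins (values from $A$, repetitions allowed) summing to $c$, and $\mathrm{grd}_A(c)$ is the number of coins used by the greedy algorithm, which repeatedly takes the largest coin not exceeding the remaining amount. $A$ is orderly if $\mathrm{opt}_A(c)=\mathrm{grd}_A(c)$ for all integers $c>0$. *)

(* Defs.v *)
From mathcomp Require Import all_boot.

Set Implicit Arguments.
Unset Strict Implicit.
Unset Printing Implicit Defensive.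

(* Coins of a currency are positive and so are the amounts, so natural numbers
   suffice; the currency (a_0, ..., a_k) is the sequence [:: a_0; ...; a_k]. *)
Definition currency (A : seq nat) : bool := (nth 0 A 0 == 1) && sorted ltn A.

(* The amount c is the sum of m coins of A (given by their indices in A,
   repetitions allowed). *)
Definition payable (A : seq nat) (c m : nat) : bool :=
  [exists t : m.-tuple 'I_(size A), \sum_(i <- t) nth 0 A i == c].

(* The least m such that c is payable with m coins. Since 1 is a coin, it is
   enough to search m <= c: see opt_payable and opt_min. *)
Definition opt (A : seq nat) (c : nat) : nat := find (payable A c) (iota 0 c.+1).

Definition greedy_coin (A : seq nat) (c : nat) : nat := \max_(a <- A | a <= c) a.

(* n is fuel: each step removes a positive amount, so c steps are enough for c;
   see grdE. *)
Fixpoint grd_rec (n : nat) (A : seq nat) (c : nat) : nat :=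
  if n is n'.+1 then
    if c == 0 then 0 else (grd_rec n' A (c - greedy_coin A c)).+1
  else 0.

Definition grd (A : seq nat) (c : nat) : nat := grd_rec c A c.

Definition orderly (A : seq nat) : Prop :=
  forall c : nat, 0 < c -> opt A c = grd A c.

Lemma payableP (A : seq nat) (c m : nat) :
  reflect (exists s : seq nat, [/\ {subset s <= A}, sumn s = c & size s = m])
          (payable A c m).
Proof.
apply: (iffP existsP) => [[t /eqP tc]|[s [sA sc sm]]].
  exists [seq nth 0 A (i : 'I_(size A)) | i <- t]; split.
  - by move=> x /mapP[i _ ->]; apply: mem_nth.
  - by rewrite sumnE big_map.
  - by rewrite size_map size_tuple.
have [t tE] : exists t : seq 'I_(size A), [seq nth 0 A (i : 'I__) | i <- t] = s.
  elim: s sA {sc sm} => [|x s IHs] sA; first by exists [::].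
  have [y ys|t <-] := IHs; first by apply: sA; rewrite inE ys orbT.
  have xA : index x A < size A by rewrite index_mem sA ?mem_head.
  by exists (Ordinal xA :: t); rewrite /= nth_index // sA ?mem_head.
have tm : size t == m by rewrite -sm -tE size_map.
by exists (Tuple tm); rewrite /= -sc -tE sumnE big_map.
Qed.

Lemma currency_mem1 (A : seq nat) : currency A -> 1 \in A.
Proof. by case: A => [|a A] //= /andP[/eqP /= -> _]; rewrite mem_head. Qed.

Lemma payable_ones (A : seq nat) (c : nat) : currency A -> payable A c c.
Proof.
move=> /currency_mem1 A1; apply/payableP; exists (nseq c 1); split.
- by move=> x /nseqP[->].
- by rewrite sumn_nseq mul1n.
- by rewrite size_nseq.
Qed.

Lemma opt_payable (A : seq nat) (c : nat) : currency A -> payable A c (opt A c).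
Proof.
move=> /payable_ones Ac.
have hA : has (payable A c) (iota 0 c.+1).
  by apply/hasP; exists c; rewrite ?mem_iota //= add0n leqnn.
have := nth_find 0 hA; rewrite nth_iota //.
by rewrite -[X in _ < X](size_iota 0) -has_find.
Qed.

Lemma opt_min (A : seq nat) (c m : nat) :
  currency A -> payable A c m -> opt A c <= m.
Proof.
move=> /payable_ones Ac Am; rewrite leqNgt; apply/negP => lt_m.
have := before_find 0 lt_m; rewrite nth_iota ?add0n ?Am //.
by rewrite -[X in _ < X](size_iota 0); apply: leq_trans lt_m (find_size _ _).
Qed.

Lemma greedy_coin_bounds (A : seq nat) (c : nat) :
  currency A -> 0 < c -> 0 < greedy_coin A c <= c.
Proof.
move=> /currency_mem1 A1 c0; apply/andP; split.
  exact: (@leq_bigmax_seq _ A (fun a => a <= c) id 1).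
by apply/bigmax_leqP_seq.
Qed.

Lemma grd_rec_fuel (A : seq nat) (n m c : nat) :
  currency A -> c <= n -> c <= m -> grd_rec n A c = grd_rec m A c.
Proof.
move=> cA; elim: n m c => [|n IHn] [|m] [|c] //= cn cm.
have /andP[g0 gc] := greedy_coin_bounds cA (ltn0Sn c).
have h : c.+1 - greedy_coin A c.+1 <= c by rewrite leq_subLR -add1n leq_add2r.
by congr _.+1; apply: IHn; apply: leq_trans h _.
Qed.

Lemma grdE (A : seq nat) (c : nat) : currency A ->
  grd A c = if c == 0 then 0 else (grd A (c - greedy_coin A c)).+1.
Proof.
move=> cA; case: c => [|c] //; rewrite {1}/grd /=; congr _.+1.
apply: grd_rec_fuel => //.
have /andP[g0 _] := greedy_coin_bounds cA (ltn0Sn c).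
by rewrite leq_subLR -add1n leq_add2r.
Qed.

(* Main.v *)
(** Write [a] for the second coin. A coin [b = q a - r] with [0 <= r < a] forms
    an orderly currency [(1, a, b)] as soon as [r < q]. Every coin [b] of an
    orderly currency satisfies this: suppose [b] is the least one with
    [q <= r]. Paying [q a] shows that there is another coin in [(b, q a]], so
    there are coins [y < H] with [H - y < b - 1]; take [H] as large as possible.
    If no coin lies in [(H, y + b]], then [t = y + b - H] must be a coin with
    [1 < t < b], say [t = p a - s] with [s < p] by minimality; but then the
    amount [y + (q - p) a = H + (r - s)] is paid with [q - p + 1] coins while
    the greedy algorithm uses [1 + r - s], and [r - s > q - p]. If [F] is a coin
    in [(H, y + b]], then [F >= H + b - 1] by maximality of [H], so [H = y + 1],
    and the greedy algorithm pays [y + a = H + (a - 1)] with [a > 2] coins. *)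
Require Import Defs.
From mathcomp Require Import all_boot.
From mathcomp Require Import zify.

Set Implicit Arguments.
Unset Strict Implicit.
Unset Printing Implicit Defensive.

(** * Single steps of the greedy algorithm *)

Lemma greedy_coinE (A : seq nat) (G c : nat) :
  G \in A -> G <= c -> {in A, forall x, x <= c -> x <= G} ->
  greedy_coin A c = G.
Proof.
move=> GA Gc maxG; apply/eqP; rewrite eqn_leq; apply/andP; split.
  by apply/bigmax_leqP_seq.
exact: (@leq_bigmax_seq _ A (fun a => a <= c) id G).
Qed.

Lemma grd_greedy (A : seq nat) (G c : nat) : currency A ->
  G \in A -> 0 < c -> G <= c -> {in A, forall x, x <= c -> x <= G} ->
  grd A c = (grd A (c - G)).+1.
Proof.
move=> cA GA c0 Gc maxG; rewrite grdE // (gtn_eqF c0).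
by rewrite (greedy_coinE GA Gc maxG).
Qed.

Lemma ex_max_coin (A : seq nat) (P : pred nat) (x : nat) :
  x \in A -> P x ->
  exists H, [/\ H \in A, P H & {in A, forall y, P y -> y <= H}].
Proof.
move=> xA Px; have ex : exists n, (n \in A) && P n by exists x; rewrite xA.
have ub n : (n \in A) && P n -> n <= \max_(i <- A) i.
  by case/andP=> nA _; apply: (@leq_bigmax_seq _ A xpredT id n).
case: (ex_maxnP ex ub) => H /andP[HA PH] maxH.
by exists H; split=> // y yA Py; apply: maxH; rewrite yA.
Qed.

Lemma grd_lt (A : seq nat) (a e : nat) : currency A ->
  {in A, forall x, x < a -> x = 1} -> e < a -> grd A e = e.
Proof.
move=> cA small; elim: e => [|e IHe] ea //.
rewrite (@grd_greedy A 1) ?currency_mem1 ?subn1 //=; first by rewrite IHe // ltnW.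
by move=> x xA xe; rewrite (small x xA) // (leq_ltn_trans xe ea).
Qed.

Lemma grd_le1 (A : seq nat) (t : nat) :
  currency A -> 0 < t -> grd A t <= 1 -> t \in A.
Proof.
move=> cA t0.
have [G [GA Gt maxG]] :=
  @ex_max_coin A (fun x => x <= t) 1 (currency_mem1 cA) t0.
rewrite (grd_greedy cA GA t0 Gt maxG) ltnS leqn0.
case: (posnP (t - G)) => [tG _|tG].
  by have -> : t = G by apply/eqP; rewrite eqn_leq Gt -subn_eq0 tG.
by rewrite grdE // (gtn_eqF tG).
Qed.

(** * What orderliness forces on the coins *)

Lemma orderly_two_coins (A : seq nat) (G y z t : nat) :
  currency A -> orderly A -> G \in A -> y \in A -> z \in A -> 0 < t ->
  y + z = G + t -> {in A, forall x, x <= y + z -> x <= G} -> t \in A.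
Proof.
move=> cA oA GA yA zA t0 yz maxG; apply: grd_le1 => //.
have yz0 : 0 < y + z by lia.
have p2 : payable A (y + z) 2.
  apply/payableP; exists [:: y; z]; split=> //=; last by rewrite addn0.
  by move=> x; rewrite !inE => /orP[] /eqP->.
(* Greedy starts with [G] and may use two coins at most, so one coin at most remains for [t]. *)
have := opt_min cA p2; rewrite oA // (grd_greedy cA GA yz0 _ maxG) ?yz ?addKn //.
lia.
Qed.

(** The payment by [y] and [j] copies of [a] has [j.+1] coins, while greedy takes [G] and then [e]
    ones, since [e < a]. *)
Lemma orderly_coin_and_multiple (A : seq nat) (a G y j e : nat) :
  currency A -> orderly A -> a \in A -> {in A, forall x, x < a -> x = 1} ->
  G \in A -> y \in A -> e < a -> 0 < G ->
  y + j * a = G + e -> {in A, forall x, x <= G + e -> x <= G} -> e <= j.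
Proof.
move=> cA oA aA small GA yA ea G0 yja maxG.
have pj : payable A (y + j * a) j.+1.
  apply/payableP; exists (y :: nseq j a); split=> /=.
  - by move=> x; rewrite inE => /orP[/eqP->|/nseqP[->]].
  - by rewrite sumn_nseq mulnC.
  - by rewrite size_nseq.
have := opt_min cA pj; rewrite yja oA ?addn_gt0 ?G0 //.
by rewrite (grd_greedy cA GA) ?addn_gt0 ?G0 ?leq_addr // addKn (grd_lt cA small).
Qed.

Lemma ex_ceil (a b : nat) : 0 < a -> exists q r, b + r = q * a /\ r < a.
Proof.
move=> a0; have := divn_eq b a; have := ltn_pmod b a0.
case: (posnP (b %% a)) => [-> _ bE|m0 ma bE].
  by exists (b %/ a), 0; rewrite addn0 {1}bE addn0.
by exists (b %/ a).+1, (a - b %% a); split; nia.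
Qed.

Lemma orderly_coin_defect (A : seq nat) (a b q r : nat) :
  currency A -> orderly A -> a \in A -> 1 < a ->
  {in A, forall x, x < a -> x = 1} -> {in A, forall x, 0 < x} ->
  b \in A -> a <= b -> b + r = q * a -> r < a -> r < q.
Proof.
move=> cA oA aA a1 small pos; elim/ltn_ind: b q r => b IHb q r bA ab bE ra.
rewrite ltnNge; apply/negP => qr.
have q2 : 1 < q by nia.
have b_gt_a : a < b by nia.
have [c [cinA cqa maxc]] := @ex_max_coin A (fun x => x <= q * a) b bA ltac:(lia).
have bc : b <= c by apply: maxc => //; lia.
(* One of the [q] copies of [a] plays the role of [y]. Since [q <= r], this bound excludes
   [c = b]. *)
have cs : q * a - c <= q.-1.
  apply: (@orderly_coin_and_multiple A a c a) => //; first by lia.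
  - exact: pos.
  - by case: (q) q2 cqa => // q' _ cqa; rewrite subnKC // mulSn.
  - by move=> x xA; rewrite subnKC //; apply: maxc.
pose near (H : nat) := has (fun y => (y < H) && (H.+1 < y + b)) A.
(* Here $b < c \le b + r$ and $r + 1 \le a < b$. *)
have near_c : near c by apply/hasP; exists b => //; lia.
have [H [HA /hasP[y yA /andP[yH Hy]] maxH]] := ex_max_coin cinA near_c.
clear c cinA cqa maxc bc cs near_c.
(* A closer coin [F] would satisfy [near] with witness [H]. *)
have gapH F : F \in A -> H < F -> H + b <= F.+1.
  move=> FA HF; rewrite leqNgt; apply/negP => FH.
  suff : F <= H by lia.
  by apply: maxH => //; apply/hasP; exists H => //; lia.
have H0 : 0 < H by lia.
case: (boolP (has (fun F => H < F <= y + b) A)) => [/hasP[F FA /andP[HF Fy]]|noF].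
  have HE : H = y.+1 by have := gapH F FA HF; lia.
  have : a.-1 <= 1.
    apply: (@orderly_coin_and_multiple A a H y 1) => //; try by lia.
    move=> x xA xH; rewrite leqNgt; apply/negP => Hx.
    by have := gapH x xA Hx; lia.
  (* Impossible, as $2 \le q \le r < a$. *)
  by nia.
have maxHy : {in A, forall x, x <= y + b -> x <= H}.
  move=> x xA xy; rewrite leqNgt; apply/negP => Hx.
  by move/hasPn: noF => /(_ x xA); rewrite Hx xy.
have tA : y + b - H \in A.
  by apply: (@orderly_two_coins A H y b) => //; lia.
move tE : (y + b - H) tA => t tA.
(* The bound [H.+1 < y + b] gives [1 < t]. *)
have ta : a <= t by rewrite leqNgt; apply/negP => /(small t tA); lia.
have [p [s [ts sa]]] := @ex_ceil a t (ltnW a1).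
have sp : s < p by apply: (IHb t) ts sa => //; lia.
have p_le_q : p <= q by nia.
have sr : s < r by lia.
have bad : r - s <= q - p.
  apply: (@orderly_coin_and_multiple A a H y) => //; [by lia|by rewrite mulnBl; nia|].
  (* The amount is $y + b + r - pa$, at most $y + b$ because $r < a \le pa$. *)
  move=> x xA xH; apply: maxHy => //; apply: leq_trans xH _.
  have : a <= p * a by rewrite leq_pmull //; lia.
  by lia.
by lia.
Qed.

(** * Closed forms of the greedy counts for $(1,a)$ and $(1,a,b)$ *)

Definition grd2 (a M : nat) : nat := M %/ a + M %% a.

Definition grd3 (a b N : nat) : nat := N %/ b + grd2 a (N %% b).

Lemma grd2Da (a M : nat) : 0 < a -> grd2 a (M + a) = (grd2 a M).+1.
Proof. by move=> a0; rewrite /grd2 divnDr // divnn a0 modnDr addn1. Qed.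

Lemma grd2E (a v w : nat) : w < a -> grd2 a (v * a + w) = v + w.
Proof.
move=> wa; have a0 : 0 < a by apply: leq_ltn_trans wa.
by rewrite /grd2 divnMDl // modnMDl modn_small // divn_small // addn0.
Qed.

Lemma grd2S (a M : nat) : 0 < a -> grd2 a M.+1 <= (grd2 a M).+1.
Proof.
move=> a0; rewrite (divn_eq M a) -addnS.
set v := M %/ a; set w := M %% a; have wa : w < a by apply: ltn_pmod.
rewrite (grd2E v wa).
have [w1|w1] := ltnP w.+1 a; first by rewrite grd2E // addnS.
have -> : v * a + w.+1 = v.+1 * a + 0 by nia.
by rewrite grd2E //; lia.
Qed.

(** Adding [b] changes quotient and remainder by $q$ and $-r$ or, with a borrow, by $q-1$ and $a-r$;
    the net gain is positive either way. *)
Lemma grd2Db (a b q r M : nat) : b + r = q * a -> r < q -> r < a ->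
  (grd2 a M).+1 <= grd2 a (M + b).
Proof.
move=> bE rq ra; have a0 : 0 < a by apply: leq_ltn_trans ra.
rewrite (divn_eq M a).
set v := M %/ a; set w := M %% a; have wa : w < a by apply: ltn_pmod.
rewrite (grd2E v wa); have [rw|wr] := leqP r w.
  have -> : v * a + w + b = (v + q) * a + (w - r) by nia.
  by rewrite grd2E; lia.
have -> : v * a + w + b = (v + q.-1) * a + (a + w - r) by nia.
by rewrite grd2E; lia.
Qed.

Lemma grd3Db (a b N : nat) : 0 < b -> grd3 a b (N + b) = (grd3 a b N).+1.
Proof. by move=> b0; rewrite /grd3 divnDr // divnn b0 modnDr addn1. Qed.

Lemma grd3E (a b u M : nat) : M < b -> grd3 a b (u * b + M) = u + grd2 a M.
Proof.
move=> Mb; have b0 : 0 < b by apply: leq_ltn_trans Mb.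
by rewrite /grd3 divnMDl // modnMDl modn_small // divn_small // addn0.
Qed.

(** Iterated over the coins of a payment, this shows that greedy never uses more coins than the
    payment. *)
Lemma grd3_add_coin (a b q r x N : nat) : 1 < a -> a < b ->
  b + r = q * a -> r < q -> r < a -> x \in [:: 1; a; b] ->
  grd3 a b (x + N) <= (grd3 a b N).+1.
Proof.
move=> a1 ab bE rq ra; have a0 := ltnW a1; have b0 : 0 < b by lia.
rewrite !inE addnC => /or3P[] /eqP->; last by rewrite grd3Db.
all: rewrite (divn_eq N b); set u := N %/ b; set M := N %% b.
all: have Mb : M < b by apply: ltn_pmod.
all: rewrite (grd3E a u Mb) -addnA.
  have [M1|M1] := ltnP (M + 1) b.
    by rewrite grd3E // -addnS leq_add2l addn1 grd2S.
  have -> : u * b + (M + 1) = u.+1 * b + 0 by nia.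
  by rewrite grd3E // {1}/grd2 div0n mod0n !addn0 ltnS leq_addr.
have [M1|M1] := ltnP (M + a) b; first by rewrite grd3E // grd2Da // addnS.
(* The extra coin [b] is offset by [grd2Db]: taking [b] out of [M + a] saves at least one coin. *)
have -> : u * b + (M + a) = u.+1 * b + (M + a - b) by nia.
have := grd2Db (M + a - b) bE rq ra; rewrite subnK // grd2Da //.
by rewrite grd3E; lia.
Qed.

Lemma grd_three (a b N : nat) : 1 < a -> a < b ->
  grd [:: 1; a; b] N = grd3 a b N.
Proof.
move=> a1 ab; have a0 := ltnW a1; have b0 : 0 < b by lia.
have cA : currency [:: 1; a; b] by rewrite /currency /= a1 ab.
elim/ltn_ind: N => -[|N] IH; first by rewrite /grd3 /grd2 !(div0n, mod0n).
have [bN|Nb] := leqP b N.+1.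
  rewrite (@grd_greedy _ b) ?inE ?eqxx ?orbT //; last first.
    by move=> x; rewrite !inE => /or3P[] /eqP-> //; lia.
  by rewrite IH ?ltn_subrL ?b0 // -grd3Db // subnK.
have g3 M : M < b -> grd3 a b M = grd2 a M.
  by move=> Mb; rewrite -[M]add0n -(mul0n b) grd3E.
rewrite g3 //; have [aN|Na] := leqP a N.+1.
  rewrite (@grd_greedy _ a) ?inE ?eqxx ?orbT //; last first.
    by move=> x; rewrite !inE => /or3P[] /eqP-> //; lia.
  by rewrite IH ?ltn_subrL ?a0 // g3 -?grd2Da // ?subnK //; lia.
rewrite (@grd_lt _ a) //; last first.
  by move=> x; rewrite !inE => /or3P[] /eqP-> //; lia.
by rewrite /grd2 divn_small // modn_small.
Qed.

Lemma orderly_three (a b q r : nat) : 1 < a -> a < b ->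
  b + r = q * a -> r < q -> r < a -> orderly [:: 1; a; b].
Proof.
move=> a1 ab bE rq ra c c0.
have cA : currency [:: 1; a; b] by rewrite /currency /= a1 ab.
apply/eqP; rewrite eqn_leq; apply/andP; split.
  (* The greedy run is itself a payment. *)
  apply: opt_min => //; apply/payableP; move: (c) {c0}; elim/ltn_ind => d IH.
  case: (posnP d) => [->|d0]; first by exists [::].
  have [G [GA Gd maxG]] :=
    @ex_max_coin [:: 1; a; b] (fun x => x <= d) 1 (mem_head _ _) d0.
  have G0 : 0 < G by move: GA; rewrite !inE => /or3P[] /eqP->; lia.
  have [|s [sA sd sz]] := IH (d - G); first by lia.
  exists (G :: s); split; last by rewrite /= sz -(grd_greedy cA GA).
  - by move=> x; rewrite inE => /orP[/eqP->|/sA].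
  - by rewrite /= sd subnKC.
have /payableP[s [sA <- <-]] := opt_payable c cA.
rewrite grd_three //; elim: s sA => [|x s IHs] sA.
  by rewrite /grd3 /grd2 !(div0n, mod0n).
apply: leq_trans (grd3_add_coin (sumn s) a1 ab bE rq ra (sA x (mem_head _ _))) _.
by rewrite /= ltnS IHs // => y ys; apply: sA; rewrite inE ys orbT.
Qed.

Theorem theorem3p5 (k : nat) (A : seq nat) (sizeA : size A = k.+1)
    (currA : currency A) (ordA : orderly A) :
  (forall l : nat, 2 <= l <= k ->
     currency [:: 1; nth 0 A 1; nth 0 A l] /\
     orderly [:: 1; nth 0 A 1; nth 0 A l]) /\
  (2 <= k ->
     currency [:: 1; nth 0 A 1; nth 0 A 2] /\
     orderly [:: 1; nth 0 A 1; nth 0 A 2]).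
Proof.
suff main l : 2 <= l <= k -> currency [:: 1; nth 0 A 1; nth 0 A l] /\
    orderly [:: 1; nth 0 A 1; nth 0 A l].
  by split=> // k2; apply: main; rewrite leqnn.
case/andP=> l2 lk; have /andP[/eqP A0 sA] := currA.
have mono i j : i < j -> j <= k -> nth 0 A i < nth 0 A j.
  by move=> ij jk; apply: (sorted_ltn_nth ltn_trans) => //; rewrite inE sizeA; lia.
have a1 : 1 < nth 0 A 1 by rewrite -[X in X < _]A0; apply: mono => //; lia.
have ab : nth 0 A 1 < nth 0 A l by apply: mono => //; lia.
split; first by rewrite /currency /= a1 ab.
have aA : nth 0 A 1 \in A by apply: mem_nth; rewrite sizeA; lia.
have bA : nth 0 A l \in A by apply: mem_nth; rewrite sizeA; lia.
have coinP x : x \in A -> x = 1 \/ nth 0 A 1 <= x.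
  move=> /(nthP 0)[[|[|i]]]; rewrite sizeA => iA <-; [by left|by right|right].
  by apply/ltnW/mono; lia.
have small : {in A, forall x, x < nth 0 A 1 -> x = 1}.
  by move=> x /coinP[] // ax; rewrite ltnNge ax.
have pos : {in A, forall x, 0 < x} by move=> x /coinP[->|] //; lia.
(* [q] is the ceiling of $a_l / a_1$. *)
have [q [r [bE ra]]] := @ex_ceil _ (nth 0 A l) (ltnW a1).
apply: (orderly_three a1 ab bE _ ra).
exact: (orderly_coin_defect currA ordA aA a1 small pos bA (ltnW ab) bE ra).
Qed.
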